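(* Let $V$ be a reduced $n\times(n+r)$ $F$-matrix with $r\ge2$, and let $\gamma\in\mathcal{A}_\Gamma(V)$ be a chamber. Then $\gamma$ is maximally bordering if and only if there exists a primitive collection $\mathcal{P}$ for $\Sigma_\gamma$ such that: (i) the corresponding primitive relation $r_{\mathbb{Z}}(\mathcal{P})$ is numerically effective, (ii) $\mathcal{P}\cap\mathcal{P}'=\emptyset$ for any primitive collection $\mathcal{P}'$ for $\Sigma_\gamma$ such that $\mathcal{P}'\ne\mathcal{P}$.
   Context: For an integer matrix $A$ with $m$ columns and $I\subseteq\{1,\dots,m\}$, $A_I$ (resp. $A^I$) is the submatrix of the columns indexed by $I$ (resp. by the complement of $I$); $\langle A\rangle$ is the convex cone generated by the columns. An $F$-matrix is an $n\times(n+r)$ integer matrix $V=(v_1,\dots,v_{n+r})$ of rank $n$ with $\langle V\rangle=\mathbb{R}^n$, all columns nonzero, and no column a positive real multiple of another one; it is reduced if every column has coprime entries. The Gale dual $Q=\mathcal{G}(V)$ has as rows a $\mathbb{Z}$-basis of $\{x\in\mathbb{Z}^{n+r}:Vx^T=0\}$ and is chosen with nonnegative entries and in row echelon form. Let $\mathcal{Q}=\langle Q\rangle\subset\mathbb{R}^r$. A chamber is a cone which is minimal, with respect to inclusion, among the $r$-dimensional cones obtained as intersections of simplicial cones generated by columns of $Q$. Set $\mathrm{Mov}(V)=\bigcap_i\langle Q^{\{i\}}\rangle$; $\mathcal{A}_\Gamma(V)$ is the set of chambers contained in $\mathrm{Mov}(V)$. For $\gamma\in\mathcal{A}_\Gamma(V)$,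 $\Sigma_\gamma$ is the simplicial complete fan with maximal cones $\langle V^J\rangle$, for $|J|=r$, $\det Q_J\ne0$, $\gamma\subseteq\langle Q_J\rangle$; $X(\Sigma_\gamma)$ is projective. $\gamma$ is maximally bordering (maxbord) if there is a hyperplane $H$ supporting $\mathcal{Q}$ with $\dim(H\cap\mathcal{Q})=r-1$ and $\dim(\gamma\cap H)=r-1$. A primitive collection for a fan $\Sigma$ with rays $\langle v_1\rangle,\dots,\langle v_{n+r}\rangle$ is a set $\mathcal{P}$ of rays which is not contained in a single cone of $\Sigma$ while every proper subset is. The vector $\sum_{\langle v_j\rangle\in\mathcal{P}}v_j$ lies in the relative interior of a unique cone $\sigma\in\Sigma$, giving a unique relation $\sum_{\langle v_j\rangle\in\mathcal{P}}v_j-\sum_{\rho\in\sigma(1)}c_\rho v_\rho=0$ with rational $c_\rho>0$; $r(\mathcal{P})\in\mathbb{Q}^{n+r}$ is its vector of coefficients and the primitive relation is $r_{\mathbb{Z}}(\mathcal{P})=l\,r(\mathcal{P})$, $l$ the least common denominator of the coefficients. It is numerically effective (nef) if all its entries are $\ge0$. *)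

(* Defs.v *)
From HB Require Import structures.
From mathcomp Require Import all_boot all_order all_algebra.
From mathcomp Require Import boolp classical_sets reals.

Set Implicit Arguments.
Unset Strict Implicit.
Unset Printing Implicit Defensive.

Import Order.TTheory GRing.Theory Num.Theory.
Local Open Scope classical_set_scope.
Local Open Scope ring_scope.

(* Columns are indexed from 0 by 'I_m, and $A_I$ keeps the columns indexed by
   I in increasing order; $A^I$ is [subcols A (~: I)]. *)
Definition subcols (d m : nat) (A : 'M[int]_(d, m)) (I : {set 'I_m})
    : 'M[int]_(d, #|I|) :=
  colsub (@enum_val _ (mem I)) A.

Section Cones.
Variable R : realType.

Definition realmx (d m : nat) (A : 'M[int]_(d, m)) : 'M[R]_(d, m) :=
  map_mx intr A.

Definition cone (d m : nat) (A : 'M[int]_(d, m)) : set 'cV[R]_d :=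
  [set x | exists c : 'cV[R]_m,
     (forall j, 0 <= c j 0) /\ x = realmx A *m c].

(* Dimension of the linear span of C; it is the dimension of C when C is a
   convex set containing 0, which is the only case in which it is used. *)
Definition has_dim (d : nat) (C : set 'cV[R]_d) (k : nat) : Prop :=
  exists U : {vspace 'cV[R]_d},
    [/\ forall x, C x -> x \in U,
        forall W : {vspace 'cV[R]_d},
          (forall x, C x -> x \in W) -> (U <= W)%VS
      & \dim U = k].

Section FMatrix.
Variables (n m : nat) (V : 'M[int]_(n, m)).

Definition F_matrix : Prop :=
  [/\ \rank (realmx V) = n,
      cone V = setT,
      forall j, col j V != 0
    & forall i j, i != j ->
        ~ exists2 t : R, 0 < t & col i (realmx V) = t *: col j (realmx V)].

End FMatrix.

Section Chambers.
Variables (r m : nat) (Q : 'M[int]_(r, m)).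

Definition simplicial (J : {set 'I_m}) : Prop :=
  \rank (realmx (subcols Q J)) = #|J|.

Definition simplicial_intersection (C : set 'cV[R]_r) : Prop :=
  exists F : {set {set 'I_m}},
    [/\ F != finset.set0,
        forall J, J \in F -> simplicial J
      & C = [set x | forall J, J \in F -> cone (subcols Q J) x]].

Definition chamber (gamma : set 'cV[R]_r) : Prop :=
  [/\ simplicial_intersection gamma,
      has_dim gamma r
    & forall C, simplicial_intersection C -> has_dim C r ->
        C `<=` gamma -> C = gamma].

Definition Mov : set 'cV[R]_r :=
  [set x | forall i : 'I_m, cone (subcols Q (finset.setC [set i]%SET)) x].

Definition hyperplane (u : 'rV[R]_r) : set 'cV[R]_r :=
  [set x | u *m x = 0].

(* A hyperplane supporting a cone contains the origin, so linear hyperplanes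
   suffice. *)
Definition maxbord (gamma : set 'cV[R]_r) : Prop :=
  exists u : 'rV[R]_r,
    [/\ u != 0,
        forall x, cone Q x -> 0 <= (u *m x) 0 0,
        has_dim (hyperplane u `&` cone Q) r.-1
      & has_dim (gamma `&` hyperplane u) r.-1].

End Chambers.

Section Fan.
Variables (n r m : nat) (V : 'M[int]_(n, m)) (Q : 'M[int]_(r, m)).
Variable gamma : set 'cV[R]_r.

(* The J such that $\langle V^J\rangle$ is a maximal cone of the fan; the cast
   makes $Q_J$ a square matrix. *)
Definition maximal_index (J : {set 'I_m}) : Prop :=
  (exists cardJ : #|J| = r,
     \det (castmx (erefl r, cardJ) (subcols Q J)) != 0) /\
  gamma `<=` cone (subcols Q J).

(* The faces of the simplicial cone $\langle V^J\rangle$ are the cones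
   generated by subsets of its columns. *)
Definition fan : set (set 'cV[R]_n) :=
  [set sigma | exists J S : {set 'I_m},
     [/\ maximal_index J, S \subset finset.setC J
       & sigma = cone (subcols V S)]].

(* $\sigma(1)$: each ray of the fan is identified with the index of the column
   generating it. *)
Definition rays (sigma : set 'cV[R]_n) : {set 'I_m} :=
  [set j | `[< cone (col j V) `<=` sigma >]]%SET.

Definition in_single_cone (P : {set 'I_m}) : Prop :=
  exists2 sigma, fan sigma & P \subset rays sigma.

Definition primitive_collection (P : {set 'I_m}) : Prop :=
  ~ in_single_cone P /\
  forall P' : {set 'I_m}, P' \proper P -> in_single_cone P'.

(* [rel_coeffs P x]: x is $r(\mathcal P)$. Strict positivity of the c_j says
   that the sum lies in the relative interior of the simplicial cone sigma.
   P and sigma(1) may overlap, in which case coefficients are collected. *)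
Definition rel_coeffs (P : {set 'I_m}) (x : 'rV[rat]_m) : Prop :=
  exists (sigma : set 'cV[R]_n) (c : 'I_m -> rat),
    [/\ fan sigma,
        forall j, j \in rays sigma -> 0 < c j,
        \sum_(j in P) col j (map_mx intr V : 'M[rat]_(n, m)) =
          \sum_(j in rays sigma) c j *: col j (map_mx intr V)
      & x = \row_j ((j \in P)%:R - (if j \in rays sigma then c j else 0))].

Definition lcd (x : 'rV[rat]_m) : nat :=
  \big[lcmn/1%N]_(j < m) `|denq (x 0%R j)|%N.

(* [primitive_relation P z]: z is $r_{\mathbb Z}(\mathcal P)$. *)
Definition primitive_relation (P : {set 'I_m}) (z : 'rV[int]_m) : Prop :=
  exists2 x : 'rV[rat]_m, rel_coeffs P x & map_mx intr z = (lcd x)%:R *: x.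

End Fan.
End Cones.

Definition reduced (n m : nat) (V : 'M[int]_(n, m)) : Prop :=
  forall j, \big[gcdn/0%N]_(i < n) `|V i j|%N = 1%N.

(* The row echelon normalisation of Q is not imposed: replacing Q by another
   basis only changes coordinates in R^r. For some orders of the columns of V
   no nonnegative basis is in row echelon form. *)
Definition gale_dual (n r m : nat) (V : 'M[int]_(n, m)) (Q : 'M[int]_(r, m))
    : Prop :=
  [/\ forall x : 'rV[int]_m,
        V *m x^T = 0 <-> exists a : 'rV[int]_r, x = a *m Q,
      forall a : 'rV[int]_r, a *m Q = 0 -> a = 0
    & forall i j, 0 <= Q i j].

Definition nef (m : nat) (z : 'rV[int]_m) : Prop := forall j, 0 <= z 0 j.

(* Main.v *)
(* Let M be the set of the J with gamma <= <Q_J>. Because gamma lies in Mov(V),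
   a set of columns spans a cone of the fan iff its index set misses some J in
   M, so primitive collections are the minimal sets meeting every J in M. By
   Gale duality, functionals u on R^r are the linear relations
   \sum_j u(q_j) v_j = 0; a nef primitive relation of P is, up to scaling, a
   functional u >= 0 on <Q> with u(q_j) > 0 exactly for j in P.

   Condition (ii) says that P is exchangeable: each J in M meets P in a single
   j, and j can be replaced in J by any k in P. If so, projection along q_j
   onto the hyperplane u = 0 maps gamma into gamma, whose trace on the
   hyperplane is therefore of dimension r - 1. Conversely, if that trace has
   dimension r - 1, then all but one of the columns of each Q_J lie in the
   hyperplane, and replacing the remaining one by any other column with
   u(q_k) > 0 gives a cone equal to gamma near a generic point of the trace, so
   it contains gamma by minimality. *)
Require Import Defs.
From HB Require Import structures.
From mathcomp Require Import all_boot all_order all_algebra.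
From mathcomp Require Import boolp classical_sets reals.

Set Implicit Arguments.
Unset Strict Implicit.
Unset Printing Implicit Defensive.

Import Order.TTheory GRing.Theory Num.Theory.
Local Open Scope classical_set_scope.
Local Open Scope ring_scope.

(** * Linear functionals on column vectors *)

Lemma mulmx_sum_col (R : comPzRingType) (d m : nat) (A : 'M[R]_(d, m))
    (c : 'cV[R]_m) : A *m c = \sum_j c j 0 *: col j A.
Proof.
apply/matrixP => i k; rewrite (ord1 k) summxE mxE.
by apply: eq_bigr => j _; rewrite !mxE mulrC.
Qed.

Definition dot (F : pzRingType) (d : nat) (u : 'rV[F]_d) (x : 'cV[F]_d) : F :=
  (u *m x) 0 0.

Section Dot.
Variables (F : comPzRingType) (d : nat).
Implicit Types (u : 'rV[F]_d) (x : 'cV[F]_d).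

Lemma dot0l x : dot 0 x = 0. Proof. by rewrite /dot mul0mx mxE. Qed.

Lemma dot0r u : dot u 0 = 0. Proof. by rewrite /dot mulmx0 mxE. Qed.

Lemma dotDr u x y : dot u (x + y) = dot u x + dot u y.
Proof. by rewrite /dot mulmxDr mxE. Qed.

Lemma dotZr u a x : dot u (a *: x) = a * dot u x.
Proof. by rewrite /dot -scalemxAr mxE. Qed.

Lemma dotBr u x y : dot u (x - y) = dot u x - dot u y.
Proof. by rewrite dotDr -scaleN1r dotZr mulN1r. Qed.

Lemma dotZl a u x : dot (a *: u) x = a * dot u x.
Proof. by rewrite /dot -scalemxAl mxE. Qed.

Lemma dotBl u v x : dot (u - v) x = dot u x - dot v x.
Proof. by rewrite /dot mulmxBl !mxE. Qed.

Lemma dot_sumr u (I : Type) (s : seq I) (P : pred I) (f : I -> 'cV[F]_d) :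
  dot u (\sum_(i <- s | P i) f i) = \sum_(i <- s | P i) dot u (f i).
Proof. by apply: (big_morph _ (dotDr u) (dot0r u)). Qed.

Lemma dot_col u (m : nat) (A : 'M_(d, m)) j : dot u (col j A) = (u *m A) 0 j.
Proof. by rewrite /dot colE mulmxA -colE [LHS]mxE. Qed.

Lemma dot_eq0 u : (forall x, dot u x = 0) -> u = 0.
Proof.
move=> u0; apply/rowP => j; rewrite mxE -(u0 (delta_mx j 0)) /dot.
by rewrite -colE mxE.
Qed.

Lemma hyperplaneE (R : realType) (v : 'rV[R]_d) (x : 'cV[R]_d) :
  hyperplane v x <-> dot v x = 0.
Proof.
split=> [|h]; first by rewrite /hyperplane /dot /= => ->; rewrite mxE.
by apply/matrixP => i j; rewrite (ord1 i) (ord1 j) [RHS]mxE; exact: h.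
Qed.

End Dot.

(** * Clearing denominators of rational vectors *)

Section Lcd.
Variable m : nat.
Implicit Types x : 'rV[rat]_m.

Lemma lcd_gt0 x : (0 < lcd x)%N.
Proof.
rewrite /lcd; elim/big_ind: _ => // [a b a0 b0|j _].
- by rewrite lcmn_gt0 a0.
- by rewrite absz_gt0 denq_neq0.
Qed.

(** Each denominator divides [lcd x], so a scaled entry is its numerator times the cofactor. This
    supplies the integral vector that [primitive_relation] asks for. *)
Lemma lcd_scale x :
  exists z : 'rV[int]_m, map_mx intr z = (lcd x)%:R *: x.
Proof.
exists (\row_j (numq (x 0 j) * (lcd x %/ `|denq (x 0 j)|)%:Z)).
apply/rowP => j; rewrite !mxE intrM.
have dv : (`|denq (x 0%R j)| %| lcd x)%N.
  by rewrite /lcd; apply: (@biglcmn_sup _ j).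
have dE : (`|denq (x 0%R j)|%N%:R : rat) = (denq (x 0 j))%:~R.
  by rewrite -[RHS](congr1 intr (absz_denq _)).
have -> : (lcd x)%:R = (lcd x %/ `|denq (x 0%R j)|)%N%:R * (denq (x 0 j))%:~R :> rat.
  by rewrite -dE -natrM divnK.
rewrite -mulrA mulrC; congr (_ * _).
rewrite -[X in _ = _ * X](divq_num_den (x 0 j)) mulrCA.
by rewrite divff ?mulr1 // intr_eq0 denq_neq0.
Qed.

End Lcd.

(** * Cones spanned by columns, and coordinates in a basis of columns *)

Lemma coneP (R : realType) (d m : nat) (A : 'M[int]_(d, m)) (x : 'cV[R]_d) :
  cone A x <-> exists2 c : 'I_m -> R,
  forall j, 0 <= c j & x = \sum_j c j *: col j (Defs.realmx R A).
Proof.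
split=> [[c [c0 ->]]|[c c0 ->]].
- by exists (fun j => c j 0) => //; rewrite mulmx_sum_col.
- exists (\col_j c j); split=> [j|]; first by rewrite mxE.
  by rewrite mulmx_sum_col; apply: eq_bigr => j _; rewrite mxE.
Qed.

Section SubcolsCone.
Variables (R : realType) (d m : nat).
Implicit Types (A : 'M[int]_(d, m)) (J : {set 'I_m}).

Lemma col_subcols A J k :
  col k (Defs.realmx R (subcols A J)) = col (enum_val k) (Defs.realmx R A).
Proof. by apply/colP => i; rewrite !mxE. Qed.

Lemma cone_subcolsP A J x : cone (subcols A J) x <-> exists2 c : 'I_m -> R,
  forall j, j \in J -> 0 <= c j & x = \sum_(j in J) c j *: col j (Defs.realmx R A).
Proof.
split=> [/coneP[c c0 ->]|[c c0 ->]].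
- exists (fun j => \sum_(k | enum_val k == j) c k) => [j _|].
    exact: sumr_ge0.
  rewrite [RHS]big_enum_val; apply: eq_bigr => k _.
  by rewrite col_subcols (big_pred1 k) // => l; apply: (inj_eq enum_val_inj).
- apply/coneP; exists (fun k => c (enum_val k)).
    by move=> k; apply: c0; apply: enum_valP.
  by rewrite big_enum_val; apply: eq_bigr => k _; rewrite col_subcols.
Qed.

Lemma cone_subcols_sub A J : cone (subcols A J) `<=` @cone R _ _ A.
Proof.
move=> x /cone_subcolsP[c c0 ->]; apply/coneP.
exists (fun j => if j \in J then c j else 0).
  by move=> j; case: ifP => // /c0.
by rewrite big_mkcond; apply: eq_bigr => j _; case: ifP; rewrite ?scale0r.
Qed.

Lemma cone_colP A j x :
  cone (col j A) x <-> exists2 t : R, 0 <= t & x = t *: col j (Defs.realmx R A).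
Proof.
have E : col ord0 (Defs.realmx R (col j A)) = col j (Defs.realmx R A).
  by apply/colP => i; rewrite !mxE.
split=> [/coneP[c c0 ->]|[t t0 ->]].
- by exists (c 0); rewrite // big_ord_recl big_ord0 addr0 E.
- apply/coneP; exists (fun=> t) => //.
  by rewrite big_ord_recl big_ord0 addr0 E.
Qed.

Lemma cone_col_sub A j J : @cone R _ _ (col j A) `<=` cone (subcols A J) <->
  cone (subcols A J) (col j (Defs.realmx R A)).
Proof.
split=> [|/cone_subcolsP[c c0 E] x /cone_colP[t t0 ->]].
  by apply; apply/cone_colP; exists 1; rewrite ?scale1r.
apply/cone_subcolsP; exists (fun i => t * c i) => [i /c0 ci|].
  exact: mulr_ge0.
by rewrite E scaler_sumr; apply: eq_bigr => i _; rewrite scalerA.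
Qed.

Lemma mem_cone_subcols A J j : j \in J ->
  cone (subcols A J) (col j (Defs.realmx R A)).
Proof.
move=> jJ; apply/cone_subcolsP; exists (fun i => (i == j)%:R).
  by move=> i _; rewrite ler0n.
rewrite (bigD1 j) //= eqxx scale1r big1 ?addr0 // => i /andP[_ /negbTE ->].
by rewrite scale0r.
Qed.

End SubcolsCone.

(* J indexes a basis of the column space; L j is the coordinate along col j A. *)
Definition coordinates (F : fieldType) (d m : nat) (A : 'M[F]_(d, m))
    (J : {set 'I_m}) (L : 'I_m -> 'rV[F]_d) : Prop :=
  (forall j k, j \in J -> k \in J -> dot (L j) (col k A) = (j == k)%:R) /\
  forall x, x = \sum_(j in J) dot (L j) x *: col j A.

(** The functionals are the rows of the inverse of the selected matrix [B]: one order of the product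
    gives duality, the other the expansion. [pinvmx] avoids a cast along [#|J| = d]. *)
Lemma coordinates_exist (F : fieldType) (d m : nat) (A : 'M[F]_(d, m))
    (J : {set 'I_m}) :
  \rank (colsub (@enum_val _ (mem J)) A) = d -> #|J| = d ->
  exists L, coordinates A J L.
Proof.
set B := colsub _ A => rB cJ.
have BV : B *m pinvmx B = 1%:M by apply: mulmxVp; rewrite /row_free rB.
have VB : pinvmx B *m B = 1%:M by apply: mulVpmx; rewrite /row_full rB cJ.
pose L j := \sum_(k | enum_val k == j) row k (pinvmx B).
have LE (k : 'I_#|J|) : L (enum_val k) = row k (pinvmx B).
  by rewrite /L (big_pred1 k) // => l; apply: (inj_eq enum_val_inj).
have cE (k : 'I_#|J|) : col (enum_val k) A = col k B.
  by apply/colP => i; rewrite !mxE.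
exists L; split=> [j k jJ kJ|x].
- rewrite -(enum_rankK_in jJ jJ) -(enum_rankK_in jJ kJ) LE cE (inj_eq enum_val_inj).
  rewrite /dot -row_mul colE mulmxA VB mul1mx.
  by rewrite !mxE eqxx andbT.
- rewrite -[LHS]mul1mx -BV -mulmxA mulmx_sum_col [RHS]big_enum_val.
  apply: eq_bigr => k _; rewrite -cE; congr (_ *: _).
  by rewrite LE /dot -row_mul [RHS]mxE.
Qed.

Lemma coordinates_inj (F : fieldType) (d m : nat) (A : 'M[F]_(d, m)) J L u :
  coordinates A J L -> (forall j, j \in J -> dot u (col j A) = 0) -> u = 0.
Proof.
move=> [_ xE] u0; apply: dot_eq0 => x; rewrite (xE x) dot_sumr.
by rewrite big1 // => j jJ; rewrite dotZr u0 ?mulr0.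
Qed.

Lemma coordinates_sum (F : fieldType) (d m : nat) (A : 'M[F]_(d, m)) J L
    (c : 'I_m -> F) j :
  coordinates A J L -> j \in J ->
  dot (L j) (\sum_(k in J) c k *: col k A) = c j.
Proof.
move=> [LE _] jJ; rewrite dot_sumr (bigD1 j) //= big1 ?addr0.
  by rewrite dotZr LE // eqxx mulr1.
by move=> k /andP[kJ kj]; rewrite dotZr LE // eq_sym (negbTE kj) mulr0.
Qed.

Lemma coordinates_cone (R : realType) (d m : nat) (A : 'M[int]_(d, m)) J L x :
  coordinates (Defs.realmx R A) J L ->
  cone (subcols A J) x <-> forall j, j \in J -> 0 <= dot (L j) x.
Proof.
move=> LJ; split=> [/cone_subcolsP[c c0 ->] j jJ|h].
- by rewrite (coordinates_sum _ LJ) // c0.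
- apply/cone_subcolsP; exists (fun j => dot (L j) x) => //.
  by case: LJ => _; apply.
Qed.

(** * Dimension and linear hyperplanes *)

Lemma lker_dot (R : realType) (d : nat) (u : 'rV[R]_d) : u != 0 ->
  exists2 W : {vspace 'cV[R]_d}, forall x, (x \in W) = (dot u x == 0)
  & \dim W = d.-1.
Proof.
move=> u0; pose f := linfun (mulmx u : 'cV[R]_d -> 'cV[R]_1).
have fE x : (x \in lker f) = (dot u x == 0).
  rewrite memv_ker lfunE /=; apply/eqP/eqP => [|h].
    by rewrite /dot => ->; rewrite mxE.
  by apply/matrixP => i j; rewrite (ord1 i) (ord1 j) [RHS]mxE; exact: h.
exists (lker f) => //.
have dE : (\dim (lker f) + \dim (limg f))%N = d.
  by rewrite -{1}[lker f]capfv limg_ker_dim dimvf /dim /= muln1.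
(* By rank-nullity it is enough that the image is a line: it lies in a space of dimension 1, and it
   is nonzero because [u] is. *)
suff d1 : \dim (limg f) = 1%N by rewrite -[in RHS]dE d1 addn1.
apply/eqP; rewrite eqn_leq; apply/andP; split.
  by apply: leq_trans (dimvS (subvf _)) _; rewrite dimvf.
rewrite lt0n dimv_eq0; apply: contra_neqN u0 => /eqP l0.
apply: dot_eq0 => x.
have : f x \in limg f by apply: memv_img; apply: memvf.
by rewrite l0 memv0 lfunE /= /dot => /eqP ->; rewrite mxE.
Qed.

Section HasDim.
Variables (R : realType) (d : nat).
Implicit Types (C : set 'cV[R]_d) (u l : 'rV[R]_d).

Lemma has_dim_full_mem C (W : {vspace 'cV[R]_d}) :
  has_dim C d -> (forall x, C x -> x \in W) -> forall x, x \in W.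
Proof.
move=> [U [_ minU dU]] /minU UW x.
have /eqP EU : U == fullv.
  by rewrite -(geq_leqif (dimv_leqif_eq (subvf U))) dU dimvf /dim /= muln1.
by apply: (subvP UW); rewrite EU memvf.
Qed.

Lemma has_dim_full_eq0 C l : has_dim C d -> (forall x, C x -> dot l x = 0) ->
  l = 0.
Proof.
move=> dC l0; have [//|ln0] := eqVneq l 0.
have [W WE _] := lker_dot ln0.
apply: dot_eq0 => x; apply/eqP; rewrite -WE.
by apply: (has_dim_full_mem dC) => y /l0 ly; rewrite WE ly.
Qed.

Lemma has_dim_full C C' : has_dim C d ->
  (forall W : {vspace 'cV[R]_d}, (forall x, C' x -> x \in W) ->
     forall x, C x -> x \in W) ->
  has_dim C' d.
Proof.
move=> dC h; exists fullv.
split=> [x _|W hW|]; first exact: memvf.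
- by apply/subvP => x _; apply: (has_dim_full_mem dC); apply: h.
- by rewrite dimvf /dim /= muln1.
Qed.

(** The span of the trace lies in the kernel of [u], which has dimension [d.-1]; equal dimensions
    mean that the trace spans the kernel. *)
Lemma has_dim_hyperplane C u : u != 0 ->
  has_dim (C `&` hyperplane u) d.-1 <->
  forall W : {vspace 'cV[R]_d},
    (forall x, C x -> dot u x = 0 -> x \in W) ->
    forall x, dot u x = 0 -> x \in W.
Proof.
move=> u0; have [H HE dH] := lker_dot u0; split.
- move=> [U [CU minU dU]] W hW x ux.
  have UH : (U <= H)%VS.
    by apply: minU => y [_ /hyperplaneE uy]; rewrite HE uy.
  have EUH : U = H.
    by apply/eqP; rewrite -(geq_leqif (dimv_leqif_eq UH)) dH dU.
  have /subvP : (U <= W)%VS by apply: minU => y [Cy /hyperplaneE]; apply: hW.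
  by apply; rewrite EUH HE ux.
- move=> h; exists H; split=> // [x [_ /hyperplaneE ux]|W hW].
    by rewrite HE ux.
  apply/subvP => x; rewrite HE => /eqP; apply: h => y Cy uy.
  by apply: hW; split=> //; apply/hyperplaneE.
Qed.

(** The spanning criterion is applied to the kernel of [l]. Vanishing on the trace of a chamber can
    thus be tested on columns of [Q] lying in the hyperplane. *)
Lemma has_dim_hyperplane_dot C u l : u != 0 ->
  has_dim (C `&` hyperplane u) d.-1 ->
  (forall x, C x -> dot u x = 0 -> dot l x = 0) ->
  forall x, dot u x = 0 -> dot l x = 0.
Proof.
move=> u0 /(has_dim_hyperplane _ u0) h l0 x ux.
have [->|ln0] := eqVneq l 0; first exact: dot0l.
have [W WE _] := lker_dot ln0.
by apply/eqP; rewrite -WE; apply: h ux => y Cy uy; rewrite WE l0.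
Qed.

End HasDim.

(** * Full rank and Gale duality *)

Lemma full_rankP (R : realType) (d m : nat) (A : 'M[int]_(d, m))
    (J : {set 'I_m}) :
  \rank (Defs.realmx R (subcols A J)) = d <->
  forall u, (forall j, j \in J -> dot u (col j (Defs.realmx R A)) = 0) -> u = 0.
Proof.
set B := Defs.realmx R (subcols A J).
have dotB u : u *m B = 0 <->
    forall j, j \in J -> dot u (col j (Defs.realmx R A)) = 0.
  split=> [uB j jJ|h].
  - by rewrite -(enum_rankK_in jJ jJ) -col_subcols -/B dot_col uB mxE.
  - apply/matrixP => i k; rewrite (ord1 i).
    by rewrite [RHS]mxE -(h _ (enum_valP k)) -col_subcols -/B dot_col.
split=> [rB u /dotB uB|h].
- have fB : row_free B by rewrite /row_free rB.
  by apply: (row_free_inj fB); rewrite uB mul0mx.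
- suff : row_free B by rewrite /row_free => /eqP.
  by apply: inj_row_free => u /dotB; apply: h.
Qed.

Lemma subcols_coordinates (R : realType) (d m : nat) (A : 'M[int]_(d, m))
    (J : {set 'I_m}) :
  \rank (Defs.realmx R (subcols A J)) = d -> #|J| = d ->
  exists L, coordinates (Defs.realmx R A) J L.
Proof.
move=> rJ; apply: coordinates_exist; rewrite -[RHS]rJ; congr (\rank _).
by apply/matrixP => i j; rewrite !mxE.
Qed.

Section Gale.
Variables (R : realType) (n r : nat).
Variables (V : 'M[int]_(n, n + r)) (Q : 'M[int]_(r, n + r)).
Hypothesis VQ : gale_dual V Q.

Let realVQ : Defs.realmx R V *m (Defs.realmx R Q)^T = 0.
Proof.
have VQ0 : V *m Q^T = 0.
  apply/matrixP => i j; rewrite [RHS]mxE.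
  have [/(_ (row j Q))[_ VQj] _ _] := VQ.
  have : V *m (row j Q)^T = 0 by apply: VQj; exists (delta_mx 0 j); rewrite rowE.
  by rewrite tr_row colE mulmxA -colE => /colP/(_ i); rewrite !mxE.
by rewrite map_trmx -map_mxM VQ0 map_mx0.
Qed.

(** Independence of the rows is given over the integers only. A rational vector in the left kernel
    becomes integral after scaling by its [lcd], and rank is invariant under extension of the field
    to [R]. *)
Let rankQ : \rank (Defs.realmx R Q) = r.
Proof.
have -> : Defs.realmx R Q = map_mx ratr (map_mx intr Q : 'M[rat]_(r, n + r)).
  by apply/matrixP => i j; rewrite !mxE ratr_int.
rewrite mxrank_map; apply/eqP; rewrite -/(row_free _).
apply: inj_row_free => y yQ.
have [z zE] := lcd_scale y.
have z0 : z = 0.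
  have [_ Qinj _] := VQ; apply: Qinj; apply/matrixP => i j.
  apply: (@intr_inj rat); have := congr1 (fun M : 'rV[rat]__ => ((lcd y)%:R *: M) i j) yQ.
  by rewrite scalemxAl -zE -map_mxM scaler0 => h; move: h; rewrite !mxE.
apply/eqP; move/eqP: zE; rewrite z0 map_mx0 eq_sym scaler_eq0 pnatr_eq0.
by rewrite (gtn_eqF (lcd_gt0 y)).
Qed.

Lemma gale_relation u :
  \sum_j dot u (col j (Defs.realmx R Q)) *: col j (Defs.realmx R V) = 0.
Proof.
rewrite -[RHS](mul0mx _ u^T) -[0 as X in X *m _]realVQ -mulmxA -trmx_mul mulmx_sum_col.
apply: eq_bigr => j _; congr (_ *: _).
by rewrite dot_col [RHS]mxE.
Qed.

(** The rows of [Q] lie in the space of linear relations, whose dimension [(n + r) - n] is the rank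
    of [Q]; hence they span it. *)
Lemma gale_functional (x : 'I_(n + r) -> R) : \rank (Defs.realmx R V) = n ->
  \sum_j x j *: col j (Defs.realmx R V) = 0 ->
  exists u, forall j, dot u (col j (Defs.realmx R Q)) = x j.
Proof.
move=> rV xV; set W := Defs.realmx R V in rV xV; set P := Defs.realmx R Q.
have PW : (P <= kermx W^T)%MS.
  by apply/sub_kermxP; rewrite -[P]trmxK -trmx_mul realVQ trmx0.
have rk : \rank (kermx W^T) = r by rewrite mxrank_ker mxrank_tr rV addKn.
have WP : (kermx W^T <= P)%MS by rewrite -(geq_leqif (mxrank_leqif_sup PW)) rankQ rk.
have : (\row_j x j <= kermx W^T)%MS.
  apply/sub_kermxP; rewrite -[\row_j _]trmxK -trmx_mul mulmx_sum_col.
  rewrite -[RHS]trmx0 -[in RHS]xV; congr (_^T); apply: eq_bigr => j _.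
  by rewrite !mxE.
move=> /submx_trans/(_ WP)/submxP[u uP]; exists u => j.
have := congr1 (fun M : 'rV_ _ => M 0 j) uP; rewrite mxE => ->.
by rewrite dot_col.
Qed.

End Gale.

(** * Maximal index sets and minimality of the chamber *)

Section Fan.
Variables (R : realType) (r m : nat) (Q : 'M[int]_(r, m)).
Variable gamma : set 'cV[R]_r.

Local Notation q j := (col j (Defs.realmx R Q)).
Local Notation maxi := (maximal_index Q gamma).

(** A nonzero integer determinant is a unit in [R], which amounts to full rank; substituting the
    cardinality equality removes the cast. *)
Lemma maximal_indexP (J : {set 'I_m}) : maxi J <->
  [/\ #|J| = r, \rank (Defs.realmx R (subcols Q J)) = r
    & gamma `<=` cone (subcols Q J)].
Proof.
have detP k (A : 'M[int]_(r, k)) (e : k = r) :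
    \det (castmx (erefl r, e) A) != 0 <-> \rank (Defs.realmx R A) = r.
  subst k; rewrite castmx_id.
  have -> : (\det A != 0) = (Defs.realmx R A \in unitmx).
    by rewrite unitmxE unitfE det_map_mx intr_eq0.
  by rewrite -row_free_unit /row_free; split=> [/eqP|->].
split=> [[[e /detP ?] ?]|[e rk ?]] //.
by split=> //; exists e; apply/detP.
Qed.

Lemma maximal_coordinates (J : {set 'I_m}) : maxi J ->
  exists L, coordinates (Defs.realmx R Q) J L /\
    forall x, gamma x -> forall j, j \in J -> 0 <= dot (L j) x.
Proof.
move=> /maximal_indexP[cJ rJ gJ]; have [L LJ] := subcols_coordinates rJ cJ.
by exists L; split=> // x /gJ /(coordinates_cone _ LJ).
Qed.

Hypothesis gammaC : chamber Q gamma.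

Lemma chamber_dot_eq0 u : (forall x, gamma x -> dot u x = 0) -> u = 0.
Proof. by case: gammaC => _ dg _; apply: has_dim_full_eq0. Qed.

(** A functional killing the columns in [J] kills [gamma], which spans the space. So these columns
    span it too, and being independent they number [r]. *)
Lemma chamber_simplicial (J : {set 'I_m}) : simplicial R Q J ->
  gamma `<=` cone (subcols Q J) -> maxi J.
Proof.
move=> sJ gJ.
have rJ : \rank (Defs.realmx R (subcols Q J)) = r.
  apply/full_rankP => u u0; apply: chamber_dot_eq0 => x /gJ /cone_subcolsP[c _ ->].
  by rewrite dot_sumr big1 // => j jJ; rewrite dotZr u0 ?mulr0.
by apply/maximal_indexP; split=> //; rewrite -rJ.
Qed.

Lemma chamber_maximal_exists : exists J, maxi J.
Proof.
case: gammaC => -[F [/finset.set0Pn[J JF] sF gE]] _ _; exists J.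
by apply: chamber_simplicial (sF _ JF) _; rewrite gE => x; apply.
Qed.

(** By [chamber_simplicial], every cone of a family defining [gamma] is itself one of the maximal
    ones. *)
Lemma chamber_cone x : (forall J, maxi J -> cone (subcols Q J) x) -> gamma x.
Proof.
case: gammaC => -[F [_ sF gE]] _ _ h; rewrite gE => J JF; apply: h.
by apply: chamber_simplicial (sF _ JF) _; rewrite gE => y; apply.
Qed.

(* Minimality of a chamber: a simplicial cone meeting it in a set of full
   dimension contains it. *)
Lemma chamber_full_intersection (J : {set 'I_m}) :
  simplicial R Q J ->
  (forall W : {vspace 'cV[R]_r},
     (forall x, gamma x -> cone (subcols Q J) x -> x \in W) ->
     forall x, gamma x -> x \in W) ->
  maxi J.
Proof.
move=> sJ h; apply: (chamber_simplicial sJ).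
case: gammaC => -[F [_ sF gE]] dg mg.
pose C : set 'cV[R]_r := gamma `&` cone (subcols Q J).
suff <- : C = gamma by move=> x [].
apply: mg => [||x []//].
- exists (J |: F)%SET; split.
  + by apply/finset.set0Pn; exists J; rewrite setU11.
  + by move=> K /setU1P[->//|/sF].
  + rewrite /C gE; apply/seteqP; split=> [x [hF hJ] K /setU1P[->//|/hF//]|x hx].
    split=> [K KF|]; first by apply: hx; rewrite setU1r.
    by apply: hx; rewrite setU11.
- by apply: has_dim_full dg _ => W hW; apply: h => x gx Jx; apply: hW.
Qed.

End Fan.

(** * Primitive collections as minimal transversals of the maximal index sets *)

Section PrimitiveCollections.
Variables (R : realType) (n r : nat).
Variables (V : 'M[int]_(n, n + r)) (Q : 'M[int]_(r, n + r)).
Variable gamma : set 'cV[R]_r.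
Hypothesis rankV : \rank (Defs.realmx R V) = n.
Hypothesis VQ : gale_dual V Q.
Hypothesis gammaC : chamber Q gamma.
Hypothesis gamma_Mov : gamma `<=` Mov Q.

Local Notation q j := (col j (Defs.realmx R Q)).
Local Notation v j := (col j (Defs.realmx R V)).
Local Notation maxi := (maximal_index Q gamma).
Local Notation primitive := (primitive_collection V Q gamma).

Lemma maximal_card J : maxi J -> #|J| = r.
Proof. by move=> /maximal_indexP[]. Qed.

Lemma maximal_dot_inj J u : maxi J -> (forall j, j \in J -> dot u (q j) = 0) ->
  u = 0.
Proof. by move=> /maximal_indexP[_ /full_rankP rJ _]; apply: rJ. Qed.

(* The inclusion in Mov is what makes every v_j span a ray of the fan: a
   relation v_j = \sum_(k in S) c_k v_k with c >= 0 is dual to a functional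
   that is >= 0 on <Q_J> and <= 0 on <Q^{j}>, hence zero on gamma. *)
Lemma rays_face (J S : {set 'I_(n + r)}) : maxi J -> [disjoint S & J]%B ->
  rays V (@cone R _ _ (subcols V S)) = S.
Proof.
move=> mJ SJ; apply/setP => j; rewrite inE; apply/asboolP/idP => [|jS]; last first.
  by apply/cone_col_sub; apply: mem_cone_subcols.
move=> /cone_col_sub/cone_subcolsP[c c0 vE]; apply/negPn/negP => jS.
have : \sum_k ((k == j)%:R - (if k \in S then c k else 0)) *: v k = 0.
  under eq_bigr do rewrite scalerBl.
  rewrite sumrB (bigD1 j) //= eqxx scale1r big1 => [|k /negbTE ->]; last first.
    by rewrite scale0r.
  rewrite addr0 {1}vE big_mkcond; apply/eqP; rewrite subr_eq0; apply/eqP.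
  by apply: eq_bigr => k _; case: ifP; rewrite ?scale0r.
move=> /(gale_functional VQ rankV)[u uE].
suff u0 : u = 0.
  by move/eqP: (uE j); rewrite u0 dot0l eqxx (negbTE jS) subr0 eq_sym oner_eq0.
apply: (chamber_dot_eq0 gammaC) => y gy; apply/eqP; rewrite eq_le; apply/andP; split.
- have /cone_subcolsP[d d0 ->] := gamma_Mov gy j.
  rewrite dot_sumr; apply: sumr_le0 => k kj.
  rewrite dotZr uE; apply: mulr_ge0_le0; first exact: d0.
  move: kj; rewrite !inE => /negbTE ->; rewrite sub0r oppr_le0.
  by case: ifP => // /c0.
- have [_ /(_ _ gy)/cone_subcolsP[d d0 ->]] := mJ.
  rewrite dot_sumr; apply: sumr_ge0 => k kJ.
  rewrite dotZr uE mulr_ge0 ?d0 // (disjointFl SJ kJ) subr0.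
  exact: ler0n.
Qed.

Lemma in_single_coneP (P : {set 'I_(n + r)}) : in_single_cone V Q gamma P <->
  exists2 J, maxi J & [disjoint P & J]%B.
Proof.
split=> [[sigma [J [S [mJ SJ ->]]]]|[J mJ PJ]].
- rewrite -finset.disjoints_subset in SJ; rewrite (rays_face mJ SJ) => PS.
  by exists J => //; apply: disjointWl PS SJ.
- exists (cone (subcols V P)); last by rewrite (rays_face mJ PJ).
  by exists J, P; split=> //; rewrite -finset.disjoints_subset.
Qed.

(** Disjointness passes to subsets, so among proper subsets only those missing a single element need
    testing. *)
Lemma primitiveP (P : {set 'I_(n + r)}) : primitive P <->
  (forall J, maxi J -> ~~ [disjoint P & J]%B) /\
  (forall k, k \in P -> exists2 J, maxi J & [disjoint (P :\ k)%SET & J]%B).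
Proof.
split=> [[nP sP]|[nP sP]].
- split=> [J mJ|k kP].
    by apply/negP => PJ; apply: nP; apply/in_single_coneP; exists J.
  by apply/in_single_coneP/sP; apply: finset.properD1.
- split=> [/in_single_coneP[J /nP/negP]//|P' /properP[PP [k kP kP']]].
  apply/in_single_coneP; have [J mJ PJ] := sP k kP; exists J => //.
  by apply: disjointWl PJ; rewrite finset.subsetD1 PP.
Qed.

Lemma primitive_subset (T : {set 'I_(n + r)}) :
  (forall J, maxi J -> ~~ [disjoint T & J]%B) ->
  exists2 P, primitive P & P \subset T.
Proof.
pose meets (S : {set 'I_(n + r)}) := `[< forall J, maxi J -> ~~ [disjoint S & J]%B >].
move=> mT; have /minset_exists[P /minsetP[/asboolP mP minP] PT] : meets T.
  exact/asboolP.
exists P => //; apply/primitiveP; split=> // k kP.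
have : ~~ meets (P :\ k)%SET.
  apply/negP => /minP/(_ (finset.subD1set _ _))/setP/(_ k).
  by rewrite !inE eqxx kP.
move=> /asboolPn/existsNP[J] /not_implyP[mJ /negP].
by rewrite negbK; exists J.
Qed.

(** Dual to [primitive_subset]: if no maximal set lay in [T], the complement of [T] would meet all
    of them and so contain a primitive collection disjoint from [T]. *)
Lemma transversal_maximal (T : {set 'I_(n + r)}) :
  (forall P, primitive P -> ~~ [disjoint P & T]%B) ->
  exists2 J, maxi J & J \subset T.
Proof.
move=> hT; apply: contrapT => nJ.
have [J mJ|P /hT PT PCT] := @primitive_subset (~: T)%SET.
  apply/negP; rewrite disjoint_sym finset.disjoints_subset finset.setCK => JT.
  by apply: nJ; exists J.
by move: PT; rewrite finset.disjoints_subset PCT.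
Qed.

Definition exchangeable (P : {set 'I_(n + r)}) : Prop :=
  forall J, maxi J -> exists j,
    [/\ j \in J, j \in P, forall k, k \in J -> k \in P -> k = j
      & forall k, k \in P -> maxi (k |: J :\ j)%SET].

Lemma exchangeable_primitive (P : {set 'I_(n + r)}) : exchangeable P <->
  primitive P /\ forall P', primitive P' -> P' <> P -> finset.setI P P' = finset.set0.
Proof.
split=> [exP|[primP disjP] J mJ].
- have nP J : maxi J -> ~~ [disjoint P & J]%B.
    by move=> /exP[j [jJ jP _ _]]; apply/pred0Pn; exists j; apply/andP.
  split=> [|P' /primitiveP[nP' sP'] neP].
  + apply/primitiveP; split=> // k kP.
    have [J0 /exP[j [_ _ uj ex]]] := chamber_maximal_exists gammaC.
    (* Since [J0] meets [P] in [j] alone, the exchanged set meets [P] in [k] alone. *)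
    exists (k |: J0 :\ j)%SET; first exact: ex.
    rewrite disjoint_sym finset.disjoints_subset; apply/fintype.subsetP => l.
    rewrite !inE; case: eqP => //= lk /andP[lj lJ].
    by apply: contraNN lj => lP; apply/eqP/uj.
  + apply/eqP; apply: contraPT neP => /finset.set0Pn[k /setIP[kP kP']]; apply.
    apply/eqP; rewrite eq_sym finset.eqEsubset; have [sPP|] := boolP (P \subset P') => /=.
      apply/fintype.subsetP => l lP'; apply/negPn/negP => lP.
      have [J mJ /(disjointWl _) PJ] := sP' l lP'.
      by move/negP: (nP J mJ); apply; apply: PJ; rewrite finset.subsetD1 sPP.
    (* Here [P'] shares [k] with [P] but lacks [l]. Some maximal [J] meets [P'] in [k] alone;
       exchanging [k] for [l] gives a maximal set that misses [P']. *)
    move=> /fintype.subsetPn[l lP lP']; have [J mJ PJ] := sP' k kP'.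
    have [j [jJ jP uj ex]] := exP J mJ.
    have kJ : k \in J.
      have /pred0Pn[i /andP[/= iP' iJ]] := nP' J mJ.
      have [<- //|ik] := eqVneq i k.
      by move: (disjointFl PJ iJ); rewrite !inE ik iP'.
    move/negP: (nP' _ (ex l lP)); case; rewrite disjoint_sym finset.disjoints_subset.
    apply/fintype.subsetP => i; rewrite !inE; case: eqP => [->//|_ /= /andP[ij iJ]].
    apply/negP => iP'; move: (disjointFl PJ iJ); rewrite !inE iP' andbT.
    by rewrite -(uj k kJ kP) in ij; rewrite ij.
- have /primitiveP[nP _] := primP.
  have /pred0Pn[j /andP[/= jP jJ]] := nP J mJ.
  have maxcard (K T : {set _}) : maxi K -> K \subset T -> (#|T| <= r)%N -> maxi T.
    move=> mK KT cT; suff <- : K = T by [].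
    by apply/eqP; rewrite eqEcard KT (maximal_card mK).
  have uj k : k \in J -> k \in P -> k = j.
    move=> kJ kP; apply/eqP; apply/negPn/negP => kj.
    (* No maximal set fits in [J :\ j], by cardinality, so some primitive [P'] avoids [J :\ j]. It
       meets [J], hence contains [j], and disjointness forces [P' = P]; then [k] cannot lie in
       [P]. *)
    have [|P' primP' P'J] := @primitive_subset (~: (J :\ j))%SET.
      move=> K mK; apply/negP; rewrite disjoint_sym finset.disjoints_subset finset.setCK.
      move=> /subset_leq_card; have -> : #|K| = #|J|.
        by rewrite (maximal_card mK) (maximal_card mJ).
      by rewrite [X in (X <= _)%N](cardsD1 j) jJ ltnn.
    have eP : P' = P.
      apply: contrapT => neP; have /primitiveP[/(_ J mJ) nP' _] := primP'.
      have /pred0Pn[i /andP[/= iP' iJ]] := nP'.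
      have := fintype.subsetP P'J i iP'; rewrite !inE iJ andbT negbK => /eqP ij.
      have := disjP P' primP' neP; move/setP/(_ j).
      by rewrite !inE jP -ij iP'.
    have := fintype.subsetP P'J k; rewrite eP => /(_ kP).
    by rewrite !inE kj kJ.
  exists j; split=> // k kP.
  (* Every primitive collection meets the exchanged set: [P] in [k], any other one in an element of
     [J] distinct from [j]. A maximal set inside it equals it by cardinality. *)
  have [P' primP'|K mK KT] := @transversal_maximal (k |: J :\ j)%SET.
    have [->|/eqP neP] := eqVneq P' P.
      by apply/pred0Pn; exists k; rewrite /= kP !inE eqxx.
    have /primitiveP[/(_ J mJ)/pred0Pn[i /andP[/= iP' iJ]] _] := primP'.
    apply/pred0Pn; exists i; rewrite /= iP' !inE iJ andbT.
    have -> : i != j; last by rewrite orbT.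
    apply/eqP => ij; have := disjP P' primP' neP; move/setP/(_ j).
    by rewrite !inE jP -ij iP'.
  apply: maxcard mK KT _.
  apply: leq_trans (eq_leq (maximal_card mJ)).
  rewrite [X in (_ <= X)%N](cardsD1 j) jJ cardsU1.
  by rewrite leq_add2r leq_b1.
Qed.

End PrimitiveCollections.

(** * The chamber as a convex cone, and small perturbations *)

Lemma cone0 (R : realType) (d m : nat) (A : 'M[int]_(d, m)) :
  cone A (0 : 'cV[R]_d).
Proof. by exists 0; split=> [j|]; rewrite ?mulmx0 ?mxE. Qed.

Lemma cone_addZ (R : realType) (d m : nat) (A : 'M[int]_(d, m)) (t : R) x y :
  0 <= t -> cone A x -> cone A y -> cone A (x + t *: y).
Proof.
move=> t0 [c [c0 ->]] [c' [c'0 ->]]; exists (c + t *: c'); split=> [j|].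
  by rewrite !mxE addr_ge0 // mulr_ge0.
by rewrite mulmxDr scalemxAr.
Qed.

Lemma dominated_perturbation (R : realFieldType) (I : finType) (A : {set I})
    (a b : I -> R) : (forall i, i \in A -> 0 < a i) ->
  exists2 e : R, 0 < e & forall i, i \in A -> 0 <= a i + e * b i.
Proof.
(* [S] bounds every ratio of [|b i|] to [a i], and the summand 1 keeps it positive, so its inverse
   is a small enough step. *)
move=> a0; pose S := 1 + \sum_(i in A) `|b i| / a i.
have term0 i : i \in A -> 0 <= `|b i| / a i.
  by move=> /a0 ai; rewrite divr_ge0 // ltW.
have S0 : 0 < S by rewrite ltr_pwDl // sumr_ge0.
exists S^-1 => [|i iA]; first by rewrite invr_gt0.
suff : S^-1 * `|b i| <= a i.
  have := ler_norm (- (S^-1 * b i)); rewrite normrN normrM gtr0_norm ?invr_gt0 //.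
  by move=> h1 /(le_trans h1); rewrite -subr_ge0 opprK.
rewrite mulrC ler_pdivrMr // -ler_pdivrMl ?a0 // mulrC /S (bigD1 i) //=.
rewrite addrCA lerDl addr_ge0 // sumr_ge0 // => k /andP[kA _]; exact: term0.
Qed.

Section ChamberCone.
Variables (R : realType) (r m : nat) (Q : 'M[int]_(r, m)).
Variable gamma : set 'cV[R]_r.
Hypothesis gammaC : chamber Q gamma.

Lemma chamber0 : gamma 0.
Proof. by apply: (chamber_cone gammaC) => J _; apply: cone0. Qed.

Lemma chamber_addZ t x y : 0 <= t -> gamma x -> gamma y -> gamma (x + t *: y).
Proof.
move=> t0 gx gy; apply: (chamber_cone gammaC) => J mJ.
by case: mJ => _ gJ; apply: cone_addZ => //; apply: gJ.
Qed.

Lemma chamber_sum (I : finType) (P : pred I) (f : I -> 'cV[R]_r) :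
  (forall i, P i -> gamma (f i)) -> gamma (\sum_(i | P i) f i).
Proof.
move=> gf; apply: big_ind => [||//]; first exact: chamber0.
by move=> x y gx gy; rewrite -[y]scale1r; apply: chamber_addZ.
Qed.

Lemma chamber_sub_cone x : gamma x -> cone Q x.
Proof.
have [J [_ gJ]] := chamber_maximal_exists gammaC.
by move=> /gJ /cone_subcols_sub.
Qed.

End ChamberCone.

(** * Maximally bordering chambers and exchangeable supports *)

Section Main.
Variables (R : realType) (n r : nat).
Variables (V : 'M[int]_(n, n + r)) (Q : 'M[int]_(r, n + r)).
Variable gamma : set 'cV[R]_r.
Hypothesis rankV : \rank (Defs.realmx R V) = n.
Hypothesis VQ : gale_dual V Q.
Hypothesis gammaC : chamber Q gamma.
Hypothesis gamma_Mov : gamma `<=` Mov Q.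

Local Notation q j := (col j (Defs.realmx R Q)).
Local Notation v j := (col j (Defs.realmx R V)).
Local Notation maxi := (maximal_index Q gamma).
Local Notation primitive := (primitive_collection V Q gamma).

(** For [u] nonnegative on the columns of [Q], these are the columns off the supporting hyperplane;
    dually, the support of the linear relation given by [u]. *)
Definition positive_support (u : 'rV[R]_r) : {set 'I_(n + r)} :=
  [set j | 0 < dot u (q j)]%SET.

(* Projecting gamma along some q_j with j in P maps it into gamma, because the
   exchange property makes q_j available in every maximal cone. *)
Lemma exchangeable_maxbord u : (forall j, 0 <= dot u (q j)) ->
  exchangeable Q gamma (positive_support u) -> maxbord Q gamma.
Proof.
move=> u_ge0 exP.
have uP j : (j \in positive_support u) = (0 < dot u (q j)) by rewrite inE.
have [J0 mJ0] := chamber_maximal_exists gammaC.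
have [j [_ jP _ _]] := exP J0 mJ0; have uj := jP; rewrite uP in uj.
have u0 : u != 0 by apply: contraTneq uj => ->; rewrite dot0l ltxx.
have proj y : gamma y -> gamma (y - (dot u y / dot u (q j)) *: q j).
  move=> gy; apply: (chamber_cone gammaC) => K mK.
  have [i [iK iP ui ex]] := exP K mK; have [_ gK] := ex j jP.
  have [c c0 yE] := iffLR (cone_subcolsP _ _ _) (gK y gy).
  have jK : j \notin (K :\ i)%SET.
    by rewrite !inE; apply/andP => -[ji /ui /(_ jP)]; apply/eqP.
  rewrite big_setU1 //= in yE.
  (* Only [i] in [K] lies in the support, so [u] vanishes on [K :\ i] and the subtracted vector is
     exactly the [q j] term of [y]. *)
  have uy : dot u y = c j * dot u (q j).
    rewrite yE dotDr dotZr dot_sumr big1 ?addr0 // => k; rewrite !inE => /andP[ki kK].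
    rewrite dotZr; apply/eqP; rewrite mulf_eq0; apply/orP; right.
    by rewrite eq_le u_ge0 andbT leNgt -uP; apply: contraNN ki => /(ui _ kK) ->.
  rewrite uy mulfK ?gt_eqF // yE [_ - _]addrC addKr.
  apply/cone_subcolsP; exists (fun k => if k == i then 0 else c k).
    by move=> k kK; case: eqP => // /eqP ki; apply: c0; rewrite !inE ki kK orbT.
  rewrite [RHS](bigD1 i) //= eqxx scale0r add0r.
  apply: eq_big => [k|k]; first by rewrite !inE andbC.
  by rewrite !inE => /andP[/negbTE ->].
have dimH : forall W : {vspace 'cV[R]_r},
    (forall x, gamma x -> dot u x = 0 -> x \in W) ->
    forall x, dot u x = 0 -> x \in W.
  move=> W gW x ux; have [H HE _] := lker_dot u0.
  (* [gamma] spans the space, and [proj] splits each of its points into a point of the trace and a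
     multiple of [q j]. For [x] in the hyperplane that multiple is zero. *)
  have : x \in (W :&: H + <[q j]>)%VS.
    case: gammaC => _ dg _; apply: (has_dim_full_mem dg) => y gy.
    rewrite -[y](subrK ((dot u y / dot u (q j)) *: q j)).
    apply: memv_add; last exact/memvZ/memv_line.
    have uy : dot u (y - (dot u y / dot u (q j)) *: q j) = 0.
      by rewrite dotBr dotZr divfK ?subrr // gt_eqF.
    by rewrite memv_cap HE uy eqxx andbT; apply: gW => //; apply: proj.
  move=> /memv_addP[w + [y /vlineP[t ->] xE]].
  rewrite memv_cap HE => /andP[wW /eqP uw].
  move: ux; rewrite xE dotDr uw add0r dotZr => /eqP.
  by rewrite mulf_eq0 (gt_eqF uj) orbF => /eqP ->; rewrite scale0r addr0.
exists u; split=> //.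
- move=> x /coneP[c c0 ->]; rewrite -/(dot _ _) dot_sumr.
  by apply: sumr_ge0 => k _; rewrite dotZr mulr_ge0.
(* The trace of the cone of [Q] contains that of [gamma], which already spans the hyperplane. *)
- rewrite classical_sets.setIC; apply/has_dim_hyperplane => // W hW; apply: dimH.
  by move=> x /(chamber_sub_cone gammaC); apply: hW.
- exact/has_dim_hyperplane.
Qed.

Lemma maxbord_exchangeable : maxbord Q gamma ->
  exists2 u, forall j, 0 <= dot u (q j) & exchangeable Q gamma (positive_support u).
Proof.
move=> [u [u0 uQ _ dimH]].
have u_ge0 j : 0 <= dot u (q j).
  apply: uQ; apply/coneP; exists (fun k => (k == j)%:R).
    by move=> k; apply: ler0n.
  rewrite (bigD1 j) //= eqxx scale1r big1 ?addr0 // => i /negbTE ->.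
  by rewrite scale0r.
have uP j : (j \in positive_support u) = (0 < dot u (q j)) by rewrite inE.
have u_eq0 j : j \notin positive_support u -> dot u (q j) = 0.
  by rewrite uP -leNgt => uj; apply/eqP; rewrite eq_le uj u_ge0.
have vanish l := has_dim_hyperplane_dot (l := l) u0 dimH.
have u_gamma x : gamma x -> 0 <= dot u x by move=> /(chamber_sub_cone gammaC)/uQ.
exists u => // J mJ; have [L [LJ Lg]] := maximal_coordinates mJ; have [LE xE] := LJ.
have dotu x : dot u x = \sum_(i in J) dot (L i) x * dot u (q i).
  by rewrite {1}(xE x) dot_sumr; apply: eq_bigr => i _; rewrite dotZr.
have [j jJ jP] : exists2 j, j \in J & j \in positive_support u.
  apply: contrapT => nJ; move/eqP: u0; apply; apply: (coordinates_inj LJ) => j jJ.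
  by apply: u_eq0; apply/negP => jP; apply: nJ; exists j.
(* On [gamma] the value of [u] is a sum of nonnegative terms; where it is zero, each term is. *)
have Lj0 k : k \in J -> k \in positive_support u ->
    forall x, gamma x -> dot u x = 0 -> dot (L k) x = 0.
  move=> kJ kP x gx; rewrite dotu => /eqP.
  rewrite psumr_eq0 => [/allP/(_ k (mem_index_enum _))/implyP/(_ kJ)|i iJ]; last first.
    by rewrite mulr_ge0 ?Lg.
  by rewrite mulf_eq0 => /orP[/eqP //|/eqP uk0]; rewrite uP uk0 ltxx in kP.
have uj := jP; rewrite uP in uj.
have uniqj k : k \in J -> k \in positive_support u -> k = j.
  move=> kJ kP; apply/eqP; apply/negPn/negP => kj.
  (* This combination of [q k] and [q j] lies in the hyperplane but has coordinate 1 along [q k]. *)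
  have := vanish (L k) (Lj0 k kJ kP) (q k - (dot u (q k) / dot u (q j)) *: q j).
  rewrite !dotBr !dotZr !LE // eqxx (negbTE kj) mulr0 subr0.
  rewrite divfK ?gt_eqF // subrr => /(_ erefl)/eqP.
  by rewrite oner_eq0.
exists j; split=> // k kP; have uk := kP; rewrite uP in uk.
have [->|kj] := eqVneq k j; first by rewrite finset.setD1K.
have kJ : k \notin J by apply: contra_neqN kj => /uniqj; apply.
have dotuj x : dot u x = dot (L j) x * dot u (q j).
  rewrite dotu (bigD1 j) //= big1 ?addr0 // => i /andP[iJ ij].
  rewrite u_eq0 ?mulr0 //; apply: contraNN ij => iP; exact/eqP/uniqj.
have Ljk : dot (L j) (q k) != 0.
  by apply: contraTneq uk; rewrite dotuj => ->; rewrite mul0r ltxx.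
have kJj : k \notin (J :\ j)%SET by rewrite !inE (negbTE kJ) andbF.
have cardJ' : #|k |: J :\ j|%SET = r.
  by rewrite cardsU1 kJj -[RHS](maximal_card mJ) [in RHS](cardsD1 j) jJ.
apply: (chamber_full_intersection gammaC).
  apply: etrans (esym cardJ'); apply/full_rankP => w w0.
  (* A functional killing [J :\ j] is a multiple of [L j], and [L j] is nonzero on [q k]. *)
  have wE : w = dot w (q j) *: L j.
    apply/eqP; rewrite -subr_eq0; apply/eqP; apply: (coordinates_inj LJ) => i iJ.
    rewrite dotBl dotZl LE // eq_sym; case: eqVneq => [->|ij].
      by rewrite mulr1 subrr.
    by rewrite mulr0 subr0 w0 // !inE ij iJ orbT.
  have : dot w (q k) = 0 by apply: w0; rewrite setU11.
  rewrite wE dotZl => /eqP; rewrite mulf_eq0 (negbTE Ljk) orbF => /eqP ->.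
  by rewrite scale0r.
(* If [L i] were zero on the whole trace, it would vanish on the hyperplane, which contains [q i].
   The sum [s] of the chosen points then has all these coordinates positive. *)
have /choice[p pP] : forall i, exists x : 'cV[R]_r, i \in (J :\ j)%SET ->
    [/\ gamma x, dot u x = 0 & 0 < dot (L i) x].
  move=> i; have [iJj|] := boolP (i \in (J :\ j)%SET); last by exists 0.
  apply: contrapT => np; move: (iJj); rewrite !inE => /andP[ij iJ].
  have ui : dot u (q i) = 0.
    by apply: u_eq0; apply: contraNN ij => /(uniqj i iJ) ->.
  suff : dot (L i) (q i) = 0 by move/eqP; rewrite LE // eqxx oner_eq0.
  apply: vanish ui => x gx ux.
  apply/eqP; rewrite eq_le Lg // andbT leNgt; apply/negP => Lx.
  by apply: np; exists x.
pose s := \sum_(i in (J :\ j)%SET) p i.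
have gs : gamma s by apply: (chamber_sum gammaC) => i /pP[].
have us : dot u s = 0 by rewrite dot_sumr big1 // => i /pP[].
have Ls i : i \in (J :\ j)%SET -> 0 < dot (L i) s.
  move=> iJ; rewrite dot_sumr (bigD1 i) //= ltr_pwDl //; first by case: (pP i iJ).
  apply: sumr_ge0 => l /andP[/pP[gl _ _] _]; apply: Lg => //.
  by move: iJ; rewrite !inE => /andP[].
(* gamma and <Q_(k |: J :\ j)> coincide near the relative interior point s of
   the facet of gamma in the hyperplane. *)
have near b : gamma b -> exists2 e : R, 0 < e &
    gamma (s + e *: b) /\ cone (subcols Q (k |: J :\ j)%SET) (s + e *: b).
  (* With this [a], [u] vanishes on [b - a *: q k]; as [u] is a multiple of [L j], the coordinate
     along [q j] is then zero. *)
  move=> gb; pose a := dot u b / dot u (q k).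
  have [e e0 he] := dominated_perturbation
    (fun i => dot (L i) b - a * dot (L i) (q k)) Ls.
  exists e => //; split; first exact: (chamber_addZ gammaC) (ltW e0) gs gb.
  apply/cone_subcolsP; exists (fun i => if i == k then e * a else
    dot (L i) s + e * (dot (L i) b - a * dot (L i) (q k))).
    move=> i; rewrite !inE; case: eqP => [_ _|_ iJ]; last by apply: he; rewrite !inE.
    by rewrite mulr_ge0 ?(ltW e0) // divr_ge0 ?(u_gamma b) ?(ltW uk).
  rewrite big_setU1 //= eqxx.
  under eq_bigr => i iJ.
    have -> : (i == k) = false by apply: contraNF kJj => /eqP <-.
    over.
  have -> : \sum_(i in (J :\ j)%SET)
      (dot (L i) s + e * (dot (L i) b - a * dot (L i) (q k))) *: q i =
      \sum_(i in J) dot (L i) (s + e *: (b - a *: q k)) *: q i.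
    rewrite [RHS](bigD1 j) //= [X in X *: _](_ : _ = 0) ?scale0r ?add0r.
      apply: eq_big => [i|i _]; first by rewrite !inE andbC.
      by rewrite dotDr dotZr dotBr dotZr.
    apply: (mulIf (lt0r_neq0 uj)); rewrite -dotuj mul0r dotDr us add0r dotZr dotBr dotZr.
    by rewrite /a divfK ?subrr ?mulr0 // gt_eqF.
  rewrite -xE addrCA; congr (_ + _).
  by rewrite scalerBr scalerA addrC subrK.
move=> W hW b gb.
(* The direction 0 gives [s] itself; subtracting it from [s + e *: b] then recovers [b]. *)
have sW : s \in W.
  have [e _] := near 0 (chamber0 gammaC); rewrite scaler0 addr0 => -[]; exact: hW.
have [e e0 [g1 c1]] := near b gb.
rewrite -[b]scale1r -(mulVf (lt0r_neq0 e0)) -scalerA memvZ //.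
by rewrite -[e *: b](addKr s) addrC memvB // hW.
Qed.

Lemma maxbordP : maxbord Q gamma <->
  exists2 u, forall j, 0 <= dot u (q j) & exchangeable Q gamma (positive_support u).
Proof. by split=> [|[u]]; [exact: maxbord_exchangeable|exact: exchangeable_maxbord]. Qed.

End Main.

(** * Nef primitive relations and nonnegative functionals *)

Section Nef.
Variables (R : realType) (n r : nat).
Variables (V : 'M[int]_(n, n + r)) (Q : 'M[int]_(r, n + r)).
Variable gamma : set 'cV[R]_r.
Hypothesis rankV : \rank (Defs.realmx R V) = n.
Hypothesis VQ : gale_dual V Q.
Hypothesis gammaC : chamber Q gamma.
Hypothesis gamma_Mov : gamma `<=` Mov Q.
Variable P : {set 'I_(n + r)}.
Hypothesis primP : primitive_collection V Q gamma P.

Local Notation q j := (col j (Defs.realmx R Q)).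
Local Notation v j := (col j (Defs.realmx R V)).
Local Notation vrat j := (col j (map_mx intr V : 'M[rat]_(n, n + r))).
Local Notation maxi := (maximal_index Q gamma).

Let primP' := iffLR (primitiveP rankV VQ gammaC gamma_Mov P) primP.

Lemma ratr_col j : map_mx ratr (vrat j) = v j.
Proof. by apply/colP => i; rewrite !mxE ratr_int. Qed.

Lemma ratr_relation (y : 'I_(n + r) -> rat) :
  \sum_j y j *: vrat j = 0 <-> \sum_j ratr (y j) *: v j = 0.
Proof.
have E : map_mx ratr (\sum_j y j *: vrat j) = \sum_j ratr (y j) *: v j.
  by rewrite map_mx_sum; apply: eq_bigr => j _; rewrite map_mxZ ratr_col.
rewrite -E; split=> [->|/eqP]; first exact: map_mx0.
by rewrite map_mx_eq0 => /eqP.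
Qed.

(** A generator of [sigma] outside [P] would have a negative coefficient. So the relation is
    supported in [P], and Gale duality turns it into [u]. *)
Lemma nef_relation_functional z : primitive_relation V Q gamma P z -> nef z ->
  exists2 u, forall j, 0 <= dot u (q j) & positive_support Q u = P.
Proof.
move=> [x [sigma [c [fs c0 sumE xE]]] zE] nz; have [nP sP] := primP'.
have [J [S [mJ SJ sE]]] := fs; rewrite -finset.disjoints_subset in SJ.
rewrite sE (rays_face rankV VQ gammaC gamma_Mov mJ SJ) in c0 sumE xE.
have x_ge0 j : 0 <= x 0 j.
  have := congr1 (fun M : 'rV_ _ => M 0 j) zE; rewrite !mxE => zj.
  have l0 : 0 < (lcd x)%:R :> rat by rewrite ltr0n lcd_gt0.
  by rewrite -(pmulr_rge0 _ l0) -zj ler0z nz.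
have SP : S \subset P.
  apply/fintype.subsetP => j jS; have := x_ge0 j; rewrite xE mxE jS.
  by case: (j \in P) => //; rewrite sub0r oppr_ge0 leNgt c0.
have xP j : j \notin P -> x 0 j = 0.
  move=> jP; rewrite xE mxE (negbTE jP).
  by rewrite ifN ?subrr //; apply: contraNN jP; apply: (fintype.subsetP SP).
have : \sum_j x 0 j *: vrat j = 0.
  transitivity (\sum_(j in P) vrat j - \sum_(j in S) c j *: vrat j); last first.
    by rewrite sumE subrr.
  rewrite [X in X - _]big_mkcond [X in _ - X]big_mkcond -sumrB.
  apply: eq_bigr => j _; rewrite xE mxE scalerBl.
  by do 2!case: ifP => _; rewrite ?scale0r ?scale1r.
move=> /ratr_relation/(gale_functional VQ rankV)[u uE].
exists u => [j|]; first by rewrite uE ler0q x_ge0.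
apply/setP => j; rewrite inE uE ltr0q.
have [jP|/xP ->] := boolP (j \in P); last by rewrite ltxx.
(* If the coefficient at [j] were zero, [u] would vanish on a maximal [K] missing [P :\ j], hence
   everywhere. All coefficients being zero, [P] would lie in [S] and so in a cone of the fan. *)
rewrite lt0r x_ge0 andbT; apply/negP => /eqP xj.
have [K mK PK] := sP j jP.
have u0 : u = 0.
  apply: (maximal_dot_inj mK) => i iK; rewrite uE.
  have := disjointFl PK iK; rewrite !inE; case: eqP => [-> _|_ /= /negbT/xP ->].
    by rewrite xj rmorph0.
  by rewrite rmorph0.
have x0 i : x 0 i = 0.
  by move: (uE i); rewrite u0 dot0l => /esym/eqP; rewrite fmorph_eq0 => /eqP.
have PS : P \subset S.
  apply/fintype.subsetP => i iP; apply: contraT => iS; move: (x0 i).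
  by rewrite xE mxE iP (negbTE iS) subr0 => /eqP; rewrite oner_eq0.
by move/negP: (nP J mJ); apply; apply: disjointWl PS SJ.
Qed.

(* A functional vanishing on all but one vector of an integral basis of R^r is
   a multiple of a rational one. *)
Lemma functional_rational u : (forall j, 0 <= dot u (q j)) ->
  positive_support Q u = P ->
  exists y : 'I_(n + r) -> rat, [/\ forall j, j \in P -> 0 < y j,
    forall j, j \notin P -> y j = 0 & \sum_j y j *: vrat j = 0].
Proof.
move=> u_ge0 uP; have [nP sP] := primP'.
have u_eq0 j : j \notin P -> dot u (q j) = 0.
  by rewrite -uP inE -leNgt => uj; apply/eqP; rewrite eq_le uj u_ge0.
have [J0 mJ0] := chamber_maximal_exists gammaC.
have /pred0Pn[k /andP[/= kP _]] := nP J0 mJ0.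
have uk : 0 < dot u (q k) by move: kP; rewrite -uP inE.
(* This [J] meets [P] in [k] alone, so [u] is a multiple of the coordinate along [q k], which is
   rational. *)
have [J mJ PJ] := sP k kP; have /maximal_indexP[cJ rJ _] := mJ.
have kJ : k \in J.
  have /pred0Pn[i /andP[/= iP iJ]] := nP J mJ.
  have [<- //|ik] := eqVneq i k.
  by move: (disjointFl PJ iJ); rewrite !inE ik iP.
pose Qrat : 'M[rat]_(r, n + r) := map_mx intr Q.
have ratQ : map_mx ratr Qrat = Defs.realmx R Q.
  by apply/matrixP => i j; rewrite !mxE ratr_int.
have [L [LE _]] : exists L, coordinates Qrat J L.
  apply: coordinates_exist cJ.
  rewrite -[RHS]rJ -(mxrank_map (@ratr R)); congr (\rank _).
  by apply/matrixP => i j; rewrite !mxE /= ratr_int.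
have dotL j : ratr (dot (L k) (col j Qrat)) = dot (map_mx ratr (L k)) (q j) :> R.
  by rewrite !dot_col -ratQ -map_mxM [RHS]mxE.
have uE : u = dot u (q k) *: map_mx ratr (L k).
  apply/eqP; rewrite -subr_eq0; apply/eqP; apply: (maximal_dot_inj mJ) => i iJ.
  rewrite dotBl dotZl -dotL LE // eq_sym; case: eqVneq => [->|ik].
    by rewrite rmorph1 mulr1 subrr.
  rewrite rmorph0 mulr0 subr0 u_eq0 //.
  by move: (disjointFl PJ iJ); rewrite !inE ik => /negbT.
have dotu j : dot u (q j) = dot u (q k) * ratr (dot (L k) (col j Qrat)).
  by rewrite {1}uE dotZl dotL.
exists (fun j => dot (L k) (col j Qrat)); split=> [j jP|j jP|].
- by rewrite -(ltr0q R) -(pmulr_rgt0 _ uk) -dotu; move: jP; rewrite -uP inE.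
- move: (dotu j); rewrite u_eq0 // => /esym/eqP.
  by rewrite mulf_eq0 (gt_eqF uk) fmorph_eq0 => /eqP.
- apply/ratr_relation; under eq_bigr do rewrite dotL.
  exact: gale_relation.
Qed.

(* Normalising the positive relation to have largest coefficient 1 turns it
   into the primitive relation, the cone sigma being spanned by the v_j whose
   coefficient is less than 1. *)
Lemma functional_nef_relation u : (forall j, 0 <= dot u (q j)) ->
  positive_support Q u = P ->
  exists2 z, primitive_relation V Q gamma P z & nef z.
Proof.
move=> u_ge0 uP; have [nP sP] := primP'.
have [y [y_gt0 yP yV]] := functional_rational u_ge0 uP.
have [J0 mJ0] := chamber_maximal_exists gammaC.
have /pred0Pn[k0 /andP[/= k0P _]] := nP J0 mJ0.
have [k kP kmax] : exists2 k, k \in P & forall j, j \in P -> y j <= y k.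
  by case: (@Order.TotalTheory.arg_maxP _ _ _ k0 (mem P) y k0P) => k; exists k.
have yk := y_gt0 k kP.
pose t j := y j / y k.
have t_ge0 j : 0 <= t j.
  rewrite divr_ge0 ?(ltW yk) //; have [/y_gt0/ltW //|/yP ->] := boolP (j \in P).
  exact: lexx.
have t_le1 j : j \in P -> t j <= 1 by move=> jP; rewrite ler_pdivrMr // mul1r kmax.
have tV : \sum_j t j *: vrat j = 0.
  transitivity ((y k)^-1 *: (\sum_j y j *: vrat j)); last by rewrite yV scaler0.
  rewrite scaler_sumr; apply: eq_bigr => j _.
  by rewrite scalerA mulrC.
pose S := [set j in P | t j < 1]%SET.
have [J mJ PJ] := sP k kP.
(* The normalised coefficient at [k] is 1, so [S] lies in [P :\ k], which misses [J]. *)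
have SJ : [disjoint S & J]%B.
  apply: disjointWl PJ; apply/fintype.subsetP => j; rewrite !inE => /andP[-> tj].
  by rewrite andbT; apply: contraTneq tj => ->; rewrite /t divff ?ltxx // lt0r_neq0.
have xt (j : 'I_(n + r)) :
    (j \in P)%:R - (if j \in S then 1 - t j else 0) = t j.
  rewrite inE; have [jP|/yP yj] := boolP (j \in P); last by rewrite subr0 /t yj mul0r.
  have [tj|tj] := ltP; first by rewrite subKr.
  by rewrite subr0; apply/eqP; rewrite eq_le tj t_le1.
have [z zE] := lcd_scale (\row_j t j).
exists z; last first.
  move=> j; rewrite -(ler0z rat); have := congr1 (fun M : 'rV_ _ => M 0 j) zE.
  by rewrite !mxE => ->; rewrite mulr_ge0.
exists (\row_j t j) => //; exists (cone (subcols V S)), (fun j => 1 - t j).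
rewrite (rays_face rankV VQ gammaC gamma_Mov mJ SJ); split.
- by exists J, S; split=> //; rewrite -finset.disjoints_subset.
- by move=> j; rewrite inE subr_gt0 => /andP[].
- apply/eqP; rewrite -subr_eq0 [X in X - _]big_mkcond [X in _ - X]big_mkcond -sumrB.
  apply/eqP; rewrite -[RHS]tV; apply: eq_bigr => j _; rewrite -[in RHS]xt [RHS]scalerBl.
  by do 2!case: ifP => _; rewrite ?scale0r ?scale1r.
- by apply/rowP => j; rewrite !mxE xt.
Qed.

End Nef.

Theorem proposition2p25 (R : realType) (n r : nat)
    (V : 'M[int]_(n, n + r)) (Q : 'M[int]_(r, n + r))
    (gamma : set 'cV[R]_r) :
  (2 <= r)%N ->
  F_matrix R V ->
  reduced V ->
  gale_dual V Q ->
  chamber Q gamma ->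
  gamma `<=` Mov Q ->
  maxbord Q gamma <->
  exists P : {set 'I_(n + r)},
    [/\ primitive_collection V Q gamma P,
        exists2 z : 'rV[int]_(n + r),
          primitive_relation V Q gamma P z & nef z
      & forall P' : {set 'I_(n + r)},
          primitive_collection V Q gamma P' -> P' <> P ->
          finset.setI P P' = finset.set0].
Proof.
move=> _ [rankV _ _ _] _ VQ gammaC gamma_Mov.
have exP := exchangeable_primitive rankV VQ gammaC gamma_Mov.
(* Exchangeability accounts for primitivity and disjointness; what remains is to trade the
   functional for a nef relation with the same support. *)
rewrite maxbordP //; split=> [[u u_ge0 /exP[primP disjP]]|[P [primP [z Pz nz] disjP]]].
- by exists (positive_support Q u); split=> //; apply: functional_nef_relation u_ge0 _.
- have [u u_ge0 uP] := nef_relation_functional rankV VQ gammaC gamma_Mov primP Pz nz.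
  by exists u => //; rewrite uP; apply/exP.
Qed.
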